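(* Let $0<\beta<1$, let $p>0$, and let $u\in W^{1,1}[-p,p]$ be a nonnegative real-valued function with $u(-p)=u(p)=0$. Define $$L=\int_{-p}^p\sqrt{1+u'(x)^2}\,dx,\qquad A=\int_{-p}^p u(x)\,dx.$$ Then $$L\ \ge\ \Big(\frac{\arccos\beta}{\sqrt{1-\beta^2}}+\beta\Big)p+\sqrt{1-\beta^2}\,\frac{A}{p},$$ with equality if and only if $u(x)=\sqrt{R^2-x^2}-\beta R$ on $[-p,p]$, where $R=\dfrac{p}{\sqrt{1-\beta^2}}$.
   Context: $W^{1,1}[-p,p]$ denotes the Sobolev space of integrable functions on $[-p,p]$ with integrable weak derivative; such functions are absolutely continuous, so the endpoint values $u(\pm p)$ are well defined. *)

(* Defs.v *)
From HB Require Import structures.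
From mathcomp Require Import all_boot all_order all_algebra.
From mathcomp Require Import all_classical all_reals all_analysis.
Set Implicit Arguments. Unset Strict Implicit. Unset Printing Implicit Defensive.
Import Order.TTheory GRing.Theory Num.Theory.
Import numFieldNormedType.Exports.
Local Open Scope classical_set_scope.
Local Open Scope ring_scope.

(* [W11_with_deriv p u g] : u belongs to W^{1,1}[-p,p] and g is (a representative
   of) its weak derivative.  On a bounded interval this means: g is Lebesgue
   integrable on [-p,p] and u is its indefinite integral,
   u x = u (-p) + \int_{-p}^x g  for every x in [-p,p]
   (u is then absolutely continuous, integrable, and u' = g a.e.). *)
Definition W11_with_deriv {R : realType} (p : R) (u g : R -> R) : Prop :=
  (@lebesgue_measure R).-integrable `[-p, p] (EFin \o g) /\
  forall x : R, x \in `[-p, p] ->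
    u x = u (- p) + Rintegral (@lebesgue_measure R) `[-p, x] g.

(* Main.v *)
Require Import Defs.
From HB Require Import structures.
From mathcomp Require Import all_boot all_order all_algebra.
From mathcomp Require Import all_classical all_reals all_analysis.
From mathcomp Require Import measurable_realfun ring lra.
Import Order.TTheory GRing.Theory Num.Theory.
Import numFieldNormedType.Exports.
Local Open Scope classical_set_scope.
Local Open Scope ring_scope.

(** With [r = p / sqrt (1 - beta^2)] and [q x = sqrt (r^2 - x^2)], the vector
    [(q x / r, - x / r)] has norm 1, so Cauchy-Schwarz against [(1, g x)] gives
    [sqrt (1 + g x ^2) >= q x / r - x / r * g x], with equality iff
    [g x = - x / q x].  Integrating, the first term is the area under a circular
    arc and the second is [A / r] by parts (Fubini, since [g] is only
    integrable), which yields the bound.  Equality thus means that [g] is a.e.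
    the slope of the circular arc, that is, that [u] is the arc itself. *)

Section circular_arcs.
Set Implicit Arguments.
Unset Strict Implicit.
Context {R : realType}.
Local Notation mu := (@lebesgue_measure R).
Implicit Types (D : set R) (a b r x : R) (f g : R -> R).

(** * Lebesgue integrals and primitives on a segment *)

(** Lebesgue differentiation: a.e. [f] is the derivative of its primitive, here a constant. It
    serves to recover the weak derivative from [u] in the equality case. *)
Lemma ae_eq0_primitive a b f : mu.-integrable `[a, b] (EFin \o f) ->
  (forall x, x \in `[a, b] -> \int[mu]_(t in `[a, x]) f t = 0) ->
  ae_eq mu `[a, b]%classic f (cst 0).
Proof.
move=> intf f0; pose f' := f \_ `[a, b].
have intf' A : measurable A -> mu.-integrable A (EFin \o f').
  move=> mA; apply: (@integrableS _ _ _ _ setT) => //.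
  rewrite -restrict_EFin; apply/integrable_restrict => //.
  by rewrite setTI.
(* Covering every real [x], also outside the segment, makes the primitive of [f'] literally the
   function [cst 0]. *)
have F0 x : \int[mu]_(t in `[a, x]) f' t = 0.
  rewrite -Rintegral_mkcondr.
  have [xb|bx] := leP x b.
    have [ax|xa] := leP a x.
      rewrite setIidl; first by apply: f0; rewrite in_itv/= ax.
      by apply: subset_itvl; rewrite bnd_simp.
    by rewrite (@set_itv_ge _ _ (BLeft a) (BRight x)) ?bnd_simp -?ltNge//
      set0I Rintegral_set0.
  rewrite setIidr; last by apply: subset_itvl; rewrite bnd_simp ltW.
  have [ab|ba] := leP a b; first by apply: f0; rewrite in_itv/= ab lexx.
  by rewrite set_itv_ge ?bnd_simp -?ltNge// Rintegral_set0.
(* [FTC1] differentiates only strictly to the right of [a]; the excluded point is a null set. *)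
have xa : \forall x \ae mu, x != a.
  exists [set a]; split=> //; first exact: lebesgue_measure_set1.
  by move=> x /= /negP; rewrite negbK => /eqP.
have := @FTC1 R f' (BLeft a) (fun y => intf' _ (measurable_itv _))
  (integrable_locally (measurable_itv _) intf).
apply: filterS2 xa; first exact: (ae_filter_ringOfSetsType mu).
move=> x xa Fx xab; have [|_] := Fx.
  by move: xab; rewrite /= in_itv/= lte_fin lt_neqAle eq_sym xa => /andP[].
rewrite (_ : (fun x => _) = cst 0); last by apply/funext => y; exact: F0.
by rewrite derive1_cst /f' patchE mem_set.
Qed.

Lemma integrable_EFinB (D : set R) f g : measurable D ->
  mu.-integrable D (EFin \o f) -> mu.-integrable D (EFin \o g) ->
  mu.-integrable D (EFin \o (f \- g)).
Proof.
move=> mD intf intg.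
rewrite (_ : EFin \o _ = (EFin \o f) \- (EFin \o g))%E//.
exact: integrableB.
Qed.

Lemma integrable_bounded_mul (D : set R) (h f : R -> R) (M : R) :
  measurable D -> measurable_fun D h -> (forall x, D x -> `|h x| <= M) ->
  mu.-integrable D (EFin \o f) -> mu.-integrable D (EFin \o (h \* f)).
Proof.
move=> mD mh hM intf; have hb : [bounded h x | x in D].
  exists M; split; first exact: num_real.
  by move=> N MN x Dx; exact/ltW/(le_lt_trans (hM _ Dx) MN).
have -> : EFin \o (h \* f) = ((EFin \o h) \* (EFin \o f))%E by [].
exact: (@integrableMr _ _ _ mu D mD h (EFin \o f) mh hb intf).
Qed.

(** Fubini on the triangle [a <= t <= x <= b]: at fixed [t] the slice in [x] has length [b - t]. *)
Lemma Rintegral_primitive a b g : mu.-integrable `[a, b] (EFin \o g) ->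
  \int[mu]_(x in `[a, b]) (\int[mu]_(t in `[a, x]) g t) =
  \int[mu]_(t in `[a, b]) ((b - t) * g t).
Proof.
move=> intg; pose D := `[a, b]%classic; pose g' := g \_ D.
have mD : measurable D by exact: measurable_itv.
have intg' : mu.-integrable setT (EFin \o g').
  by rewrite -restrict_EFin; apply/integrable_restrict => //; rewrite setTI.
have mg' : measurable_fun setT g'.
  by case/integrableP : intg' => /measurable_EFinP.
have intbg : mu.-integrable D (EFin \o (fun t => (b - t) * g t)).
  apply: (@integrable_bounded_mul _ _ _ (b - a)) => //.
    exact: measurable_funB.
  move=> t; rewrite /D/= in_itv/= => /andP[lat tb].
  by rewrite ger0_norm ?subr_ge0// lerB.
(* Pairs are [(t, x)]. The missing constraint [a <= t] is supplied by [g'], which vanishes outside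
   [D]. *)
pose S := [set z : R * R | z.1 <= z.2 <= b].
have mS : measurable S.
  rewrite -[S]setTI; apply: (@measurable_and _ _ setT) => //.
    exact: measurable_fun_ler.
  exact: measurable_fun_ler.
pose k (z : R * R) : R := g' z.1 * \1_S z.
have mk : measurable_fun setT k.
  by apply: measurable_funM; [exact: measurableT_comp|exact: measurable_indic].
have SE t x : \1_S (t, x) = \1_(`[t, b]%classic) x :> R.
  rewrite !indicE; suff -> : ((t, x) \in S) = (x \in `[t, b]%classic) by [].
  by apply/idP/idP => /set_mem; rewrite /= ?in_itv/= => ?; apply/mem_set;
    rewrite /= ?in_itv.
have intS t c : t <= b ->
    (\int[mu]_x (c * \1_S (t, x))%:E = (c * (b - t))%:E)%E.
  move=> tb; transitivity (\int[mu]_(x in `[t, b]) c%:E)%E.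
    rewrite [RHS]integral_mkcond; apply: eq_integral => x _.
    by rewrite SE indicE patchE; case: ifP; rewrite ?mulr1 ?mulr0.
  rewrite integral_cst//= lebesgue_measure_itv/= lte_fin.
  move: tb; rewrite le_eqVlt => /predU1P[->|->]; last by rewrite -EFinD -EFinM.
  by rewrite ltxx subrr mulr0 mule0.
have g'0 t : b < t -> g' t = 0.
  by move=> bt; rewrite /g' patchE memNset// /D/= in_itv/= (leNgt t) bt andbF.
(* Tonelli: integrating [|k|] over [x] first leaves [|(b - t) * g t|], whose integral is finite by
   [intbg]. *)
have ik : (mu \x mu)%E.-integrable setT (EFin \o k).
  apply/integrable12ltyP; first exact/measurable_EFinP.
  rewrite [ltLHS](_ : _ = \int[mu]_(t in D) `|((b - t) * g t)%:E|)%E.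
    by case/integrableP : intbg.
  rewrite [RHS]integral_mkcond; apply: eq_integral => t _.
  transitivity (\int[mu]_x (`|g' t| * \1_S (t, x))%:E)%E.
    by apply: eq_integral => x _;
      rewrite /k /= normrM (ger0_norm (_ : 0 <= \1_S _)).
  have [tb|bt] := leP t b; last first.
    rewrite patchE memNset; last by rewrite /D/= in_itv/= (leNgt t) bt andbF.
    by rewrite g'0// normr0; under eq_integral do rewrite mul0r;
      rewrite integral0.
  rewrite intS// patchE /g' patchE; case: ifP => _;
    last by rewrite normr0 mul0r.
  by rewrite /= normrM mulrC (ger0_norm (_ : 0 <= b - t)) ?subr_ge0.
have := Fubini ik.
(* Inner integral over [x]: the slice length times [g' t]. *)
rewrite [LHS](_ : _ = \int[mu]_(t in D) ((b - t) * g t)%:E)%E; last first.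
  rewrite [RHS]integral_mkcond; apply: eq_integral => t _.
  have [tb|bt] := leP t b; last first.
    rewrite patchE memNset; last by rewrite /D/= in_itv/= (leNgt t) bt andbF.
    under eq_integral do rewrite /k /= g'0// mul0r.
    by rewrite integral0.
  rewrite /k/= intS// patchE /g' patchE; case: ifP => _; last by rewrite mul0r.
  by rewrite mulrC.
(* Inner integral over [t]: the primitive of [g] at [x], or 0 when [x] is outside [D]. *)
rewrite [RHS](_ : _ = \int[mu]_(x in D) (\int[mu]_(t in `[a, x]) g t)%:E)%E;
  last first.
  rewrite [RHS]integral_mkcond; apply: eq_integral => x _; rewrite patchE.
  case: ifPn => [|].
    rewrite inE /D/= in_itv/= => /andP[ax xb].
    have sxD : `[a, x] `<=` D by apply: subset_itvl; rewrite bnd_simp.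
    rewrite /Rintegral fineK; last first.
      by apply: integrable_fin_num => //; exact: (@integrableS _ _ _ mu D).
    rewrite [RHS]integral_mkcond; apply: eq_integral => t _.
    rewrite /k/= SE indicE /g' !patchE !mem_setE /D/= !in_itv/=.
    rewrite xb andbT; case: (leP a t) => //= lat; rewrite ?mul0r//.
    by case: (leP t x) => tx; rewrite ?(le_trans tx xb)/= ?mulr1 ?mulr0.
  rewrite notin_setE /D/= in_itv/= => /negP; rewrite negb_and -!ltNge => xD.
  rewrite integral0_eq// => t _;
    rewrite /k/= SE indicE /g' patchE !mem_setE /D/= !in_itv/=.
  case: (leP a t) => //= lat; rewrite ?mul0r//.
  case: (leP t x) => tx //=; rewrite ?mulr0//.
  case/orP : xD => [|bx]; first by rewrite ltNge (le_trans lat tx).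
  by rewrite (leNgt x) bx mulr0.
by rewrite /Rintegral => ->.
Qed.

Lemma Rintegral_derivable a b f (F : R -> R) : a <= b ->
  {in `[a, b], forall x, is_derive x 1 F (f x)} ->
  {within `[a, b], continuous f} ->
  \int[mu]_(x in `[a, b]) f x = F b - F a.
Proof.
rewrite le_eqVlt => /predU1P[<- _ _|ab dF cf].
  by rewrite set_itv1 Rintegral_set1 subrr.
have cF x : x \in `[a, b] -> {for x, continuous F}.
  by move=> /dF dFx; exact/differentiable_continuous/derivable1_diffP.
have dF' : derivable_oo_LRcontinuous F a b.
  split => [x /subset_itv_oo_cc /dF||].
  - by move=> dFx; exact: ex_derive.
  - by apply: cvg_at_right_filter; apply: cF; rewrite in_itv/= lexx ltW.
  - by apply: cvg_at_left_filter; apply: cF; rewrite in_itv/= lexx ltW.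
rewrite /Rintegral (continuous_FTC2 ab cf dF')// => x /subset_itv_oo_cc /dF dFx.
by rewrite derive1E derive_val.
Qed.

(** * Differential calculus on the half circle *)

Lemma half_circle_gt0 r x : `|x| < r -> 0 < Num.sqrt (r ^+ 2 - x ^+ 2).
Proof.
move=> xr; rewrite sqrtr_gt0 subr_gt0 -(real_normK (num_real x)).
by rewrite ltr_pXn2r// nnegrE// ltW// (le_lt_trans _ xr).
Qed.

Lemma is_derive_half_circle r x : `|x| < r ->
  is_derive x 1 (fun y => Num.sqrt (r ^+ 2 - y ^+ 2))
    (- x / Num.sqrt (r ^+ 2 - x ^+ 2)).
Proof.
move=> xr; have q0 : 0 < r ^+ 2 - x ^+ 2 by rewrite -sqrtr_gt0 half_circle_gt0.
have ds := is_derive1_sqrt q0.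
have di : is_derive x 1 (fun y : R => r ^+ 2 - y ^+ 2) (- (2 * x)).
  by apply: is_derive_eq; rewrite /GRing.scale/=; ring.
have dc := @is_derive1_comp _ Num.sqrt (fun y : R => r ^+ 2 - y ^+ 2) x
  _ _ ds di.
apply: (is_derive_eq dc); rewrite /GRing.scale/=; field.
by rewrite lt0r_neq0// sqrtr_gt0.
Qed.

(** The antiderivative is the area under the arc from 0 to [y]: a right triangle with legs [y] and
    [sqrt (r^2 - y^2)], plus a sector of angle [asin (y / r)]. *)
Lemma is_derive_circular_segment r x : `|x| < r ->
  is_derive x 1
    (fun y => (y * Num.sqrt (r ^+ 2 - y ^+ 2) + r ^+ 2 * asin (y / r)) / 2)
    (Num.sqrt (r ^+ 2 - x ^+ 2)).
Proof.
move=> xr; have r0 : 0 < r by exact: le_lt_trans xr.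
have q0 : 0 < r ^+ 2 - x ^+ 2 by rewrite -sqrtr_gt0 half_circle_gt0.
have dq := is_derive_half_circle xr.
have xr1 : -1 < x / r < 1.
  by move: xr; rewrite ltr_norml ltr_pdivrMr// ltr_pdivlMr// mulN1r mul1r.
have da := is_derive1_asin xr1.
have di : is_derive x 1 (fun y : R => y / r) r^-1.
  by apply: is_derive_eq; rewrite /GRing.scale/=; ring.
have dc := @is_derive1_comp _ asin (fun y : R => y / r) x _ _ da di.
have sE : Num.sqrt (1 - (x / r) ^+ 2) = Num.sqrt (r ^+ 2 - x ^+ 2) / r.
  rewrite -[X in _ = _ / X]ger0_norm ?ltW// -sqrtr_sqr -sqrtrV ?sqr_ge0//
    -sqrtrM ?ltW//.
  by congr Num.sqrt; field; rewrite gt_eqF.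
rewrite sE in dc.
apply: is_derive_eq; rewrite /GRing.scale/=.
have := sqr_sqrtr (ltW q0).
have : 0 < Num.sqrt (r ^+ 2 - x ^+ 2) by rewrite sqrtr_gt0.
(* With the root abstracted as [q] and [r ^+ 2] replaced by [q ^+ 2 + x ^+ 2], the claim is a
   rational identity. *)
move: (Num.sqrt _) => q qp qE.
have rE : r ^+ 2 = q ^+ 2 + x ^+ 2 by rewrite qE; ring.
rewrite (_ : r ^+ 2 * (_ / r) = r ^+ 2 / q); last by field; rewrite !gt_eqF.
by rewrite rE; field; rewrite gt_eqF.
Qed.

Lemma within_continuous_half_circle r a b :
  {in `[a, b], forall x, `|x| < r} ->
  {within `[a, b], continuous (fun y => Num.sqrt (r ^+ 2 - y ^+ 2))}.
Proof.
move=> h; apply: derivable_within_continuous => x /h.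
by move=> /is_derive_half_circle dx; exact: ex_derive.
Qed.

(** * The pointwise length bound *)

(** Lagrange's identity [E1]: the square of the left side and that of [(q * g + x) / r] add up to
    [1 + g ^+ 2]. Dropping the second square gives the bound; it vanishes exactly when
    [g = - x / q]. *)
Lemma sqrt_ge_tangent (r q x g : R) :
  0 < r -> 0 < q -> q ^+ 2 + x ^+ 2 = r ^+ 2 ->
  q / r - x / r * g <= Num.sqrt (1 + g ^+ 2) ?= iff (g == - x / q).
Proof.
move=> r0 q0 E.
have E1 : (q / r - x / r * g) ^+ 2 + ((q * g + x) / r) ^+ 2 = 1 + g ^+ 2.
  rewrite -[RHS](@mulfK _ (r ^+ 2)) ?sqrf_eq0 ?gt_eqF// -{1}E; field.
  by rewrite gt_eqF.
have gE : (g == - x / q) = ((q * g + x) / r == 0).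
  rewrite mulf_eq0 invr_eq0 (gt_eqF r0) orbF.
  apply/eqP/eqP => [->|/eqP]; first by field; rewrite gt_eqF.
  by rewrite addr_eq0 => /eqP <-; field; rewrite gt_eqF.
have N2 : Num.sqrt (1 + g ^+ 2) ^+ 2 = 1 + g ^+ 2.
  by rewrite sqr_sqrtr// addr_ge0// sqr_ge0.
split.
  rewrite (le_trans (ler_norm _))// -sqrtr_sqr ler_sqrt ?addr_ge0 ?sqr_ge0//.
  by rewrite -E1 lerDl sqr_ge0.
rewrite gE; apply/eqP/eqP => [TN|d0].
  apply/eqP; rewrite -sqrf_eq0 -(inj_eq (addrI (Num.sqrt (1 + g ^+ 2) ^+ 2))).
  by rewrite -{1}TN E1 addr0 N2.
(* [E1] determines the left side only up to sign; substituting [x = - (q * g)] turns it into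
   [q / r * (1 + g ^+ 2)], which is nonnegative. *)
rewrite -E1 d0 expr0n addr0 sqrtr_sqr ger0_norm//.
have {}d0 : x = - (q * g).
  by apply/eqP; rewrite -addr_eq0 addrC; move/eqP : d0;
    rewrite mulf_eq0 invr_eq0 (gt_eqF r0) orbF.
rewrite d0 (_ : _ - _ = q / r * (1 + g ^+ 2)); last by ring.
by rewrite mulr_ge0// ?addr_ge0 ?sqr_ge0// divr_ge0 ?ltW.
Qed.

(** * Area and slope of a circular arc *)

(** Keeps the half chord [r * sin t] strictly below [r], so that the half circle is differentiable
    up to the ends of the chord. *)
Lemma sin_lt1_pihalf (t : R) : 0 <= t < pi / 2 -> sin t < 1.
Proof.
move=> /andP[t0 tpi]; have ct : 0 < cos t.
  by apply: cos_gt0_pihalf;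
    rewrite tpi andbT (lt_le_trans _ t0)// oppr_lt0 divr_gt0// pi_gt0.
rewrite lt_neqAle sin_le1 andbT; apply/eqP => s1.
by have := cos2Dsin2 t; have := exprn_gt0 2 ct; rewrite s1; lra.
Qed.

(** Here [t] is half the angle subtended by the arc: the sector contributes [r^2 t], and the two
    right triangles beside it [r^2 sin t cos t]. *)
Lemma Rintegral_half_circle r t : 0 < r -> 0 <= t < pi / 2 ->
  \int[mu]_(x in `[- (r * sin t), r * sin t]) Num.sqrt (r ^+ 2 - x ^+ 2) =
  r ^+ 2 * (t + sin t * cos t).
Proof.
move=> r0 tpi; have s1 := sin_lt1_pihalf tpi; move/andP : (tpi) => [t0 tpi2].
have pi0 : 0 < pi / 2 :> R by rewrite divr_gt0// pi_gt0.
have s0 : 0 <= sin t.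
  by apply: sin_ge0_pi;
    rewrite t0 (le_trans (ltW tpi2))// ler_pdivrMr// ler_peMr ?pi_ge0// ler1n.
have c0 : 0 <= cos t.
  by apply: cos_ge0_pihalf;
    rewrite (ltW tpi2) andbT (le_trans _ t0)// oppr_le0 ltW.
have xr x : x \in `[- (r * sin t), r * sin t] -> `|x| < r.
  rewrite in_itv/= -ler_norml => /le_lt_trans; apply.
  by rewrite gtr_pMr.
rewrite (Rintegral_derivable _
  (fun x h => is_derive_circular_segment (xr x h))); first last.
- exact: within_continuous_half_circle.
- by rewrite ge0_cp// mulr_ge0// ltW.
have rN0 : r != 0 by rewrite gt_eqF.
have qE : Num.sqrt (r ^+ 2 - (r * sin t) ^+ 2) = r * cos t.
  rewrite exprMn -{1}[r ^+ 2]mulr1 -mulrBr -cos2sin2 -exprMn sqrtr_sqr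
    ger0_norm//.
  by rewrite mulr_ge0// ltW.
rewrite sqrrN qE.
have -> : r * sin t / r = sin t by field.
have -> : - (r * sin t) / r = sin (- t) by rewrite sinN; field.
rewrite !sinK; first by field.
- by rewrite in_itv/= lerNl opprK ltW//= lerNl (le_trans _ t0)// oppr_le0 ltW.
- by rewrite in_itv/= (ltW tpi2) andbT (le_trans _ t0)// oppr_le0 ltW.
Qed.

Lemma within_continuous_half_circle_slope r a b :
  {in `[a, b], forall x, `|x| < r} ->
  {within `[a, b], continuous (fun y => - y / Num.sqrt (r ^+ 2 - y ^+ 2))}.
Proof.
move=> ab; apply: derivable_within_continuous => x /ab xr.
have dq := is_derive_half_circle xr.
apply: derivableM => //; apply: derivableV => //.
by rewrite gt_eqF// half_circle_gt0.
Qed.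

Lemma Rintegral_half_circle_slope r a b : a <= b ->
  {in `[a, b], forall x, `|x| < r} ->
  \int[mu]_(x in `[a, b]) (- x / Num.sqrt (r ^+ 2 - x ^+ 2)) =
  Num.sqrt (r ^+ 2 - b ^+ 2) - Num.sqrt (r ^+ 2 - a ^+ 2).
Proof.
move=> ab abr.
rewrite (Rintegral_derivable ab (fun x h => is_derive_half_circle (abr x h)))//.
exact: within_continuous_half_circle_slope.
Qed.

(** * Arc length and integration by parts *)

(** Domination by [1 + |g|]; this makes the extended real [L] of the theorem finite. *)
Lemma integrable_arclength a b g : mu.-integrable `[a, b] (EFin \o g) ->
  mu.-integrable `[a, b] (EFin \o (fun x => Num.sqrt (1 + g x ^+ 2))).
Proof.
move=> intg; have mg : measurable_fun `[a, b] g.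
  by case/integrableP : intg => /measurable_EFinP.
have int1 : mu.-integrable `[a, b] (EFin \o cst 1).
  apply: continuous_compact_integrable; first exact: segment_compact.
  by apply: continuous_subspaceT; exact: cst_continuous.
have intb : mu.-integrable `[a, b] (EFin \o (fun x => 1 + `|g x|)).
  rewrite (_ : EFin \o _ = (EFin \o cst 1%R) \+ (abse \o (EFin \o g)))%E//.
  by apply: integrableD => //; exact: integrable_abse.
apply: (@le_integrable _ _ _ mu _ _ _ _ _ _ intb) => //.
- apply/measurable_EFinP; apply: measurableT_comp.
    by apply: continuous_measurable_fun; exact: sqrt_continuous.
  by apply: measurable_funD => //; exact: measurable_funX.
- move=> x _; rewrite /= lee_fin ger0_norm ?sqrtr_ge0// ger0_norm ?addr_ge0//.
  rewrite -(@ler_pXn2r _ 2)// ?nnegrE ?sqrtr_ge0 ?addr_ge0//.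
  rewrite sqr_sqrtr ?addr_ge0 ?sqr_ge0// sqrrD expr1n real_normK ?num_real//.
  by rewrite lerD2r lerDl mul1r mulrn_wge0.
Qed.

(** [Rintegral_primitive] turns the integral of [u] into that of [(p - t) * g t]; the part [p * g]
    integrates to [p * (u p - u (- p)) = 0]. *)
Lemma Rintegral_mulx_deriv (p : R) (u g : R -> R) :
  W11_with_deriv p u g -> u (- p) = 0 -> u p = 0 -> 0 <= p ->
  \int[mu]_(x in `[-p, p]) (x * g x) = - \int[mu]_(x in `[-p, p]) u x.
Proof.
move=> [intg ug] uNp up p0.
have bx x : `[-p, p]%classic x -> `|x| <= p by rewrite /= in_itv/= -ler_norml.
have intxg : mu.-integrable `[-p, p] (EFin \o (fun x => x * g x)).
  exact: (@integrable_bounded_mul _ _ _ p).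
have intpg : mu.-integrable `[-p, p] (EFin \o (fun x => p * g x)).
  by apply: (@integrable_bounded_mul _ (cst p) _ p) => // x _;
    rewrite ger0_norm.
have -> : \int[mu]_(x in `[-p, p]) u x =
    \int[mu]_(x in `[-p, p]) (\int[mu]_(t in `[-p, x]) g t).
  by apply: eq_Rintegral => x /set_mem /ug ->; rewrite uNp add0r.
rewrite Rintegral_primitive//.
under [in RHS]eq_Rintegral do rewrite mulrBl.
rewrite RintegralB// RintegralZl//.
have := ug p; rewrite up uNp add0r in_itv/= lexx ge0_cp// => <-//.
by rewrite mulr0 sub0r opprK.
Qed.

End circular_arcs.

Local Notation mu := lebesgue_measure.

(** * The inequality and its equality case *)

Theorem mainTheorem2 (R : realType) (beta p : R) (u g : R -> R) :
  0 < beta -> beta < 1 -> 0 < p ->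
  W11_with_deriv p u g ->
  (forall x : R, x \in `[-p, p] -> 0 <= u x) ->
  u (- p) = 0 -> u p = 0 ->
  let L := (\int[@lebesgue_measure R]_(x in `[(-p)%R, p]%classic) (Num.sqrt (1 + g x ^+ 2)%R)%:E)%E in
  let A := Rintegral (@lebesgue_measure R) `[-p, p]%classic u in
  let rhs := (acos beta / Num.sqrt (1 - beta ^+ 2) + beta) * p
             + Num.sqrt (1 - beta ^+ 2) * (A / p) in
  let Rad := p / Num.sqrt (1 - beta ^+ 2) in
  (rhs%:E <= L)%E /\
  (L = rhs%:E <->
   forall x : R, x \in `[-p, p] -> u x = Num.sqrt (Rad ^+ 2 - x ^+ 2) - beta * Rad).
Proof.
move=> b0 b1 p0 W11 _ uNp up L A rhs r; have [intg ug] := W11.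
pose D := `[-p, p]%classic.
have mD : measurable D by exact: measurable_itv.
(* With [t = acos beta]: [s = sin t], [p = r * sin t] and [beta * r = r * cos t]. So [[-p, p]] is a
   chord at distance [beta * r] from the centre, of half angle [t]. *)
pose s := Num.sqrt (1 - beta ^+ 2).
have s0 : 0 < s by rewrite sqrtr_gt0 subr_gt0 expr_lt1// ltW.
have rE : r = p / s by [].
have r0 : 0 < r by rewrite divr_gt0.
have pE : p = r * s by rewrite rE divfK// gt_eqF.
have bE : -1 <= beta <= 1.
  by rewrite (ltW b1) andbT (le_trans _ (ltW b0))// lerN10.
have sE : sin (acos beta) = s by rewrite sin_acos.
have cE : cos (acos beta) = beta by rewrite acosK.
have tpi : 0 <= acos beta < pi / 2.
  have pi0 := pi_gt0 R.
  rewrite acos_ge0//= -ltr_cos ?in_itv/= ?acos_ge0 ?acos_lepi ?cos_pihalf ?cE//.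
  by rewrite divr_ge0 ?ltW//= ltr_pdivrMr// ltr_pMr// ltr1n.
have s1 : s < 1 by rewrite -sE sin_lt1_pihalf.
(* The segment lies strictly inside the radius, so [q] is positive and the slope [h] continuous up
   to the endpoints. *)
have Dr x : x \in `[-p, p] -> `|x| < r.
  rewrite in_itv/= -ler_norml => /le_lt_trans; apply.
  by rewrite pE gtr_pMr.
pose q x := Num.sqrt (r ^+ 2 - x ^+ 2).
pose h x := - x / q x.
have qp : q p = beta * r.
  have s2 : s ^+ 2 = 1 - beta ^+ 2.
    by rewrite sqr_sqrtr ?subr_ge0 ?expr_le1 ?ltW.
  rewrite /q pE (_ : _ - _ = (beta * r) ^+ 2);
    last by rewrite [(r * s) ^+ 2]exprMn s2; ring.
  by rewrite sqrtr_sqr ger0_norm// mulr_ge0// ltW.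
have qNp : q (- p) = beta * r by rewrite -qp /q sqrrN.
have q2 x : x \in `[-p, p] -> q x ^+ 2 + x ^+ 2 = r ^+ 2.
  by move=> /Dr/half_circle_gt0; rewrite sqrtr_gt0 => /ltW q0;
    rewrite sqr_sqrtr// subrK.
(* The component of [(1, g x)] along the unit tangent [(q x / r, - x / r)] of the arc. *)
pose phi x := q x / r - x / r * g x.
pose len x := Num.sqrt (1 + g x ^+ 2).
have tangent x : x \in `[-p, p] -> phi x <= len x ?= iff (g x == h x).
  by move=> xD; apply: sqrt_ge_tangent => //;
    [exact/half_circle_gt0/Dr|exact: q2].
have intq : mu.-integrable D (EFin \o q).
  apply: continuous_compact_integrable; first exact: segment_compact.
  by apply: within_continuous_half_circle => x; exact: Dr.
have inth : mu.-integrable D (EFin \o h).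
  apply: continuous_compact_integrable; first exact: segment_compact.
  by apply: within_continuous_half_circle_slope => x; exact: Dr.
have intxg : mu.-integrable D (EFin \o (fun x => x * g x)).
  apply: (@integrable_bounded_mul _ _ _ _ p) => //.
  by move=> x; rewrite /D/= in_itv/= -ler_norml.
have phiE : phi = (fun x => r^-1 * q x - r^-1 * (x * g x)).
  by apply/funext => x; rewrite /phi; ring.
have intq' : mu.-integrable D (EFin \o (fun x => r^-1 * q x)).
  by apply: (@integrable_bounded_mul _ _ (cst r^-1) _ `|r^-1|).
have intxg' : mu.-integrable D (EFin \o (fun x => r^-1 * (x * g x))).
  by apply: (@integrable_bounded_mul _ _ (cst r^-1) _ `|r^-1|).
have intphi : mu.-integrable D (EFin \o phi).
  by rewrite phiE; exact: integrable_EFinB.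
have intlen : mu.-integrable D (EFin \o len) by exact: integrable_arclength.
(* The area under [q], divided by [r], gives [r * (acos beta + s * beta)], and the parts formula
   gives [A / r]; then [r = p / s]. *)
have phi_rhs : \int[mu]_(x in D) phi x = rhs.
  rewrite phiE RintegralB// RintegralZl// RintegralZl//.
  rewrite (Rintegral_mulx_deriv W11)// ?ltW// -/A.
  have -> : \int[mu]_(x in D) q x = r ^+ 2 * (acos beta + s * beta).
    by have := Rintegral_half_circle r0 tpi; rewrite sE cE -pE.
  rewrite /rhs -/s rE; field.
  by rewrite !gt_eqF.
have LE : L = (\int[mu]_(x in D) len x)%:E.
  by rewrite /Rintegral fineK//; exact: integrable_fin_num.
have aeF := ae_filter_ringOfSetsType (@lebesgue_measure R).
have subD x : x \in `[-p, p] -> `[-p, x] `<=` D.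
  by rewrite in_itv/= => /andP[_ xp]; apply: subset_itvl; rewrite bnd_simp.
have intS (f : R -> R) x : x \in `[-p, p] -> mu.-integrable D (EFin \o f) ->
    mu.-integrable `[-p, x] (EFin \o f).
  by move=> xD; apply: (@integrableS _ _ _ mu D) => //; exact: subD.
have prim_u x : x \in `[-p, p] -> \int[mu]_(t in `[-p, x]) g t = u x.
  by move=> /ug ->; rewrite uNp add0r.
have prim_h x : x \in `[-p, p] -> \int[mu]_(t in `[-p, x]) h t = q x - beta * r.
  move=> xD; rewrite -qNp; apply: Rintegral_half_circle_slope.
    by move: xD; rewrite in_itv/= => /andP[].
  by move=> t /(subD _ xD); exact: Dr.
(* Both sides are primitives vanishing at [- p]: a.e. equal slopes integrate to equal functions, and
   conversely [g - h] has zero primitive. *)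
have uE : ae_eq mu D g h <-> (forall x, x \in `[-p, p] -> u x = q x - beta * r).
  split=> [gh x xD|uq].
    rewrite -prim_u// -prim_h// /Rintegral; congr fine.
    apply: ae_eq_integral => //.
    - by case/integrableP : (intS _ _ xD intg).
    - by case/integrableP : (intS _ _ xD inth).
    - by apply: filterS gh => t gh tx; rewrite /= gh//; exact: subD tx.
  have gh0 : ae_eq mu D (fun x => g x - h x) (cst 0).
    apply: ae_eq0_primitive; first exact: integrable_EFinB.
    move=> x xD; rewrite RintegralB//; [|exact: intS|exact: intS].
    by rewrite prim_u// prim_h// uq// subrr.
  by apply: filterS gh0 => x gh xD; apply/eqP; rewrite -subr_eq0 gh.
(* The gap [w] is nonnegative, so its integral is that of [|w|] and vanishes iff [w] is a.e. 0, that
   is, iff the tangent bound is a.e. an equality. *)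
have lenE :
    \int[mu]_(x in D) len x = \int[mu]_(x in D) phi x <-> ae_eq mu D g h.
  pose w x := len x - phi x.
  have intw : mu.-integrable D (EFin \o w) by exact: integrable_EFinB.
  have w0 x : D x -> 0 <= w x.
    by move=> xD; rewrite subr_ge0; exact: (tangent x xD).1.
  have wE x : D x -> w x = 0 <-> g x = h x.
    move=> xD; split => [/eqP|/eqP].
      by rewrite subr_eq0 eq_sym (tangent x xD).2 => /eqP.
    by rewrite -(tangent x xD).2 => /eqP E; rewrite /w E subrr.
  have mw : measurable_fun D (EFin \o w) by case/integrableP : intw.
  have Ew : (\int[mu]_(x in D) `|(EFin \o w) x| = (\int[mu]_(x in D) w x)%:E)%E.
    rewrite /Rintegral fineK; last exact: integrable_fin_num.
    by apply: eq_integral => x /set_mem /w0 wx; rewrite /= ger0_norm.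
  have := ae_eq_integral_abs mu mD mw; rewrite Ew RintegralB// => -[w1 w2].
  split=> [lp|gh].
    have : ae_eq mu D (EFin \o w) (cst 0%E) by apply: w1; rewrite lp subrr.
    by apply: filterS => x wx xD; apply/wE => //; case: (wx xD).
  have [] : (\int[mu]_(x in D) len x - \int[mu]_(x in D) phi x)%:E = 0%E.
    by apply: w2; apply: filterS gh => x gh xD; rewrite /= (wE x xD).2// gh.
  by move/eqP; rewrite subr_eq0 => /eqP.
rewrite LE lee_fin -phi_rhs; split.
  by apply: le_Rintegral => // x xD; exact: (tangent x xD).1.
by rewrite -uE -lenE; split => [[]|->].
Qed.
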